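(* Let $(L,\cdot,[\;,\;])$ be a Poisson algebra, and define a ternary operation on $L$ by $$[x,y,z]=x\cdot[y,z]+y\cdot[z,x]+z\cdot[x,y],\quad\forall x,y,z\in L.$$ If this operation makes $(L,[\;,\;,\;])$ a 3-Lie algebra, then $(L,\cdot,[\;,\;,\;])$ is a transposed Poisson 3-Lie algebra. In particular, if $(L,\cdot,[\;,\;])$ is a strong Poisson algebra, then $(L,[\;,\;,\;])$ is a 3-Lie algebra and $(L,\cdot,[\;,\;,\;])$ is a transposed Poisson 3-Lie algebra.
   Context: All vector spaces are over a field $K$ of characteristic zero. Commutative associative algebras are not assumed unital. A Poisson algebra is a triple $(L,\cdot,[\;,\;])$ where $(L,\cdot)$ is a commutative associative algebra, $(L,[\;,\;])$ is a Lie algebra, and $[x,y\cdot z]=[x,y]\cdot z+y\cdot[x,z]$ for all $x,y,z\in L$. It is called strong if $[h,x]\cdot[y,z]+[h,y]\cdot[z,x]+[h,z]\cdot[x,y]=0$ for all $x,y,z,h\in L$. A 3-Lie algebra is a vector space $A$ with a skew-symmetric trilinear map $[\;,\;,\;]:\otimes^3A\to A$ such that, for all $x,y,z,u,v\in A$, $[[x,y,z],u,v]=[[x,u,v],y,z]+[[y,u,v],z,x]+[[z,u,v],x,y]$. It is a known result of Dzhumadil'daev that for a strong Poisson algebra the ternary operation in the claim defines a 3-Lie algebra. A transposed Poisson 3-Lie algebra is a triple $(L,\cdot,[\;,\;,\;])$ where $(L,\cdot)$ is a commutative associative algebra, $(L,[\;,\;,\;])$ is a 3-Lie algebra, and $3u\cdot[x,y,z]=[x\cdot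 u,y,z]+[x,y\cdot u,z]+[x,y,z\cdot u]$ for all $x,y,z,u\in L$. *)

(* Defs.v *)
From HB Require Import structures.
From mathcomp Require Import all_boot all_order all_algebra.

Set Implicit Arguments.
Unset Strict Implicit.
Unset Printing Implicit Defensive.

Import GRing.Theory.
Local Open Scope ring_scope.

(* The carrier L is an arbitrary K-vector space, possibly infinite-dimensional;
   the operations are plain functions on L, constrained by the predicates. *)

Definition bilinear_op (K : fieldType) (L : lmodType K) (f : L -> L -> L) : Prop :=
  (forall y, linear (fun x => f x y)) /\ (forall x, linear (fun y => f x y)).

Definition trilinear_op (K : fieldType) (L : lmodType K)
    (f : L -> L -> L -> L) : Prop :=
  [/\ forall y z, linear (fun x => f x y z),
      forall x z, linear (fun y => f x y z)
    & forall x y, linear (fun z => f x y z)].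

Definition skew_symmetric3 (K : fieldType) (L : lmodType K)
    (f : L -> L -> L -> L) : Prop :=
  forall x y z, [/\ f y x z = - f x y z, f x z y = - f x y z
                  & f z y x = - f x y z].

(* No unit is required. *)
Record comm_assoc_algebra (K : fieldType) (L : lmodType K)
    (mul : L -> L -> L) : Prop := CommAssocAlgebra {
  caa_bilinear : bilinear_op mul;
  caa_comm : commutative mul;
  caa_assoc : associative mul
}.

Record lie_algebra (K : fieldType) (L : lmodType K)
    (br : L -> L -> L) : Prop := LieAlgebra {
  lie_bilinear : bilinear_op br;
  lie_alternating : forall x, br x x = 0;
  lie_jacobi : forall x y z, br x (br y z) + br y (br z x) + br z (br x y) = 0
}.

Record poisson_algebra (K : fieldType) (L : lmodType K)
    (mul br : L -> L -> L) : Prop := PoissonAlgebra {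
  poisson_mul : comm_assoc_algebra mul;
  poisson_lie : lie_algebra br;
  poisson_leibniz :
    forall x y z, br x (mul y z) = mul (br x y) z + mul y (br x z)
}.

Record strong_poisson_algebra (K : fieldType) (L : lmodType K)
    (mul br : L -> L -> L) : Prop := StrongPoissonAlgebra {
  strong_poisson : poisson_algebra mul br;
  strong_identity : forall x y z h,
    mul (br h x) (br y z) + mul (br h y) (br z x) + mul (br h z) (br x y) = 0
}.

Record three_lie_algebra (K : fieldType) (L : lmodType K)
    (br3 : L -> L -> L -> L) : Prop := ThreeLieAlgebra {
  lie3_trilinear : trilinear_op br3;
  lie3_skew : skew_symmetric3 br3;
  lie3_fundamental : forall x y z u v,
    br3 (br3 x y z) u v =
      br3 (br3 x u v) y z + br3 (br3 y u v) z x + br3 (br3 z u v) x y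
}.

Record transposed_poisson_3lie_algebra (K : fieldType) (L : lmodType K)
    (mul : L -> L -> L) (br3 : L -> L -> L -> L) : Prop :=
  TransposedPoisson3LieAlgebra {
  tp3_mul : comm_assoc_algebra mul;
  tp3_lie3 : three_lie_algebra br3;
  tp3_compat : forall x y z u,
    3%:R *: mul u (br3 x y z) =
      br3 (mul x u) y z + br3 x (mul y u) z + br3 x y (mul z u)
}.

Definition poisson_bracket3 (K : fieldType) (L : lmodType K)
    (mul br : L -> L -> L) (x y z : L) : L :=
  mul x (br y z) + mul y (br z x) + mul z (br x y).

(* Main.v *)
Require Import Defs.
From HB Require Import structures.
From mathcomp Require Import all_boot all_order all_algebra.
From mathcomp Require Import ring.

(** Write [x,y,z] for [poisson_bracket3].  Expanding [xu,y,z] by the Leibniz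
    rule gives u[x,y,z] + xy[z,u] + xz[u,y]; summed over the three slots, the
    extra terms cancel in pairs, which is the transposed Leibniz rule
    ([bracket3_transposed_leibniz]).  It holds in every Poisson algebra.

    For the fundamental identity, the Leibniz rule expands [h, [x,y,z]] into
    terms x[h,[y,z]] and products of two brackets; the latter add up to the
    left-hand side of the strong identity, so they vanish
    ([strong_br_bracket3]).  After this simplification, both sides of the
    fundamental identity consist of
    - terms x[y,z][u,v], the same on both sides, and, on the right only, terms
      u[v,x][y,z] and v[x,u][y,z], which add up to u and v times instances of
      the strong identity;
    - terms xy[z,[u,v]], which cancel, and ux[v,[y,z]] or vx[u,[y,z]], which
      agree by the Jacobi identity, read as the fact that [v, -] and [u, -]
      are derivations of the Lie bracket ([lie_derivation]).

    The resulting identities are polynomial in the brackets of the variables.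
    They are checked in the unitization K + L, a commutative unital ring in
    which L embeds. *)

Set Implicit Arguments.
Unset Strict Implicit.
Unset Printing Implicit Defensive.

Import GRing.Theory.
Local Open Scope ring_scope.

(** The unitization of a commutative associative algebra: the vector space
    K + L, in which (a, x) stands for a 1 + x.  The proof of the algebra axioms
    is a parameter of the type, so that the ring structure can be inferred. *)
Definition unitization (K : fieldType) (L : lmodType K) (mul : L -> L -> L)
  (hA : comm_assoc_algebra mul) : Type := (K * L)%type.

Section Unitization.

Variables (K : fieldType) (L : lmodType K) (mul : L -> L -> L).
Hypothesis hA : comm_assoc_algebra mul.

Let U := unitization hA.

HB.instance Definition _ := GRing.Zmodule.copy U (K * L)%type.

Let mulPl a x y z : mul (a *: x + y) z = a *: mul x z + mul y z.
Proof. exact: (caa_bilinear hA).1. Qed.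

Let mulDl x y z : mul (x + y) z = mul x z + mul y z.
Proof. by have := mulPl 1 x y z; rewrite !scale1r. Qed.

Let mul0l z : mul 0 z = 0.
Proof. by apply: (addrI (mul 0 z)); rewrite -mulDl !addr0. Qed.

Let mulZl a x z : mul (a *: x) z = a *: mul x z.
Proof. by have := mulPl a x 0 z; rewrite mul0l !addr0. Qed.

Let mulDr x y z : mul z (x + y) = mul z x + mul z y.
Proof. by rewrite !(caa_comm hA z) mulDl. Qed.

Let mulZr a x z : mul z (a *: x) = a *: mul z x.
Proof. by rewrite !(caa_comm hA z) mulZl. Qed.

(** The unit and the product of K + L: (a 1 + x)(b 1 + y) is
    ab 1 + (a y + b x + xy). *)
Definition unitization_one : U := (1, 0).

Definition unitization_mul (p q : U) : U :=
  (p.1 * q.1, p.1 *: q.2 + q.1 *: p.2 + mul p.2 q.2).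

Let unitization_mulA : associative unitization_mul.
Proof.
move=> [a x] [b y] [c z]; rewrite /unitization_mul /= mulrA; congr pair.
rewrite !mulDl !mulDr !mulZl !mulZr !scalerDr !scalerA (caa_assoc hA).
rewrite (mulrC c a) (mulrC c b) -!addrA; congr (_ + (_ + _)).
rewrite addrCA; congr (_ + _).
by rewrite (addrCA (b *: _) (c *: _)) addrCA.
Qed.

Let unitization_mulC : commutative unitization_mul.
Proof.
move=> [a x] [b y]; rewrite /unitization_mul /= mulrC (caa_comm hA x).
by rewrite [a *: y + _]addrC.
Qed.

Let unitization_mul1 : left_id unitization_one unitization_mul.
Proof.
move=> [a x]; rewrite /unitization_mul /=.
by rewrite mul1r scale1r scaler0 mul0l !addr0.
Qed.

Let unitization_mulDl : left_distributive unitization_mul +%R.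
Proof.
move=> [a x] [b y] [c z]; rewrite /unitization_mul /=; congr pair.
  by rewrite mulrDl.
by rewrite scalerDl scalerDr mulDl /= (addrACA (a *: z)) [RHS]addrACA.
Qed.

Let unitization_one_neq0 : unitization_one != 0.
Proof. by apply/eqP => -[/eqP]; rewrite oner_eq0. Qed.

HB.instance Definition _ := GRing.Zmodule_isComNzRing.Build U
  unitization_mulA unitization_mulC unitization_mul1 unitization_mulDl
  unitization_one_neq0.

(** The embedding of L as an ideal of its unitization. *)
Definition unitization_in (x : L) : U := (0, x).

(** The embedding of K in the unitization; it turns scaling by K into a product
    of the ring. *)
Definition unitization_scalar (a : K) : U := (a, 0).

Lemma unitization_in_inj : injective unitization_in.
Proof. by move=> x y []. Qed.

Lemma unitization_inD x y :
  unitization_in (x + y) = unitization_in x + unitization_in y.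
Proof. by congr pair; rewrite addr0. Qed.

Lemma unitization_inN x : unitization_in (- x) = - unitization_in x.
Proof. by congr pair; rewrite oppr0. Qed.

Lemma unitization_inM x y :
  unitization_in (mul x y) = unitization_in x * unitization_in y.
Proof. by congr pair; rewrite /= ?mul0r // !scale0r !add0r. Qed.

Lemma unitization_inZ a x :
  unitization_in (a *: x) = unitization_scalar a * unitization_in x.
Proof. by congr pair; rewrite /= ?mulr0 // scale0r mul0l !addr0. Qed.

Lemma unitization_scalar_nat n : unitization_scalar n%:R = n%:R.
Proof.
elim: n => [|n IHn] //; rewrite -!natr1 -IHn.
by congr pair; rewrite /= addr0.
Qed.

End Unitization.

Section LieAlgebra.

Variables (K : fieldType) (L : lmodType K) (br : L -> L -> L).
Hypothesis hL : lie_algebra br.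

Lemma lie_linearl a x y z : br (a *: x + y) z = a *: br x z + br y z.
Proof. exact: (lie_bilinear hL).1. Qed.

Lemma lie_linearr a x y z : br z (a *: x + y) = a *: br z x + br z y.
Proof. exact: (lie_bilinear hL).2. Qed.

Lemma lie_addl x y z : br (x + y) z = br x z + br y z.
Proof. by have := lie_linearl 1 x y z; rewrite !scale1r. Qed.

Lemma lie_addr x y z : br z (x + y) = br z x + br z y.
Proof. by have := lie_linearr 1 x y z; rewrite !scale1r. Qed.

Lemma lie_anti x y : br y x = - br x y.
Proof.
apply/eqP; rewrite -addr_eq0 addrC; apply/eqP.
have := lie_alternating hL (x + y).
by rewrite lie_addl !lie_addr !(lie_alternating hL) add0r addr0.
Qed.

Lemma lie_oppr x y : br x (- y) = - br x y.
Proof.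
have br0 : br x 0 = 0 by apply: (addrI (br x 0)); rewrite -lie_addr !addr0.
by apply/eqP; rewrite -addr_eq0 -lie_addr addNr br0.
Qed.

Lemma lie_derivation v y z :
  br v (br y z) = br y (br v z) - br z (br v y).
Proof.
have := lie_jacobi hL v y z; rewrite (lie_anti v z) lie_oppr => /eqP.
by rewrite -addrA addr_eq0 opprD opprK => /eqP.
Qed.

End LieAlgebra.

Section PoissonAlgebra.

Variables (K : fieldType) (L : lmodType K) (mul br : L -> L -> L).
Hypothesis hP : poisson_algebra mul br.

Let hA := poisson_mul hP.
Let hL := poisson_lie hP.
Let iota := unitization_in hA.
Let iotaE := (unitization_inD hA, unitization_inN hA, unitization_inM hA,
  unitization_inZ hA).

Local Notation br3 := (poisson_bracket3 mul br).

Lemma bracket3_trilinear : trilinear_op br3.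
Proof.
by split=> y z a x x'; apply: (@unitization_in_inj _ _ _ hA);
  rewrite /= /poisson_bracket3 !(lie_linearl hL, lie_linearr hL) !iotaE; ring.
Qed.

Lemma bracket3_skew : skew_symmetric3 br3.
Proof.
move=> x y z; split; apply: (@unitization_in_inj _ _ _ hA);
  rewrite /poisson_bracket3 (lie_anti hL y x) (lie_anti hL z y)
    (lie_anti hL x z) !iotaE; ring.
Qed.

Lemma bracket3_transposed_leibniz x y z u :
  3%:R *: mul u (br3 x y z) =
    br3 (mul x u) y z + br3 x (mul y u) z + br3 x y (mul z u).
Proof.
apply: (@unitization_in_inj _ _ _ hA); rewrite /poisson_bracket3.
(* The Leibniz rule concerns the second argument of the bracket. *)
rewrite (lie_anti hL y (mul x u)) (lie_anti hL z (mul y u)).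
rewrite (lie_anti hL x (mul z u)) !(poisson_leibniz hP).
rewrite (lie_anti hL y x) (lie_anti hL z y) (lie_anti hL x z).
rewrite !iotaE unitization_scalar_nat; ring.
Qed.

Hypothesis strong : strong_poisson_algebra mul br.

Lemma strong_br_bracket3 h x y z :
  br h (br3 x y z) =
    mul x (br h (br y z)) + mul y (br h (br z x)) + mul z (br h (br x y)).
Proof.
rewrite -[RHS]add0r -(strong_identity strong x y z h).
apply: (@unitization_in_inj _ _ _ hA).
rewrite /poisson_bracket3 !(lie_addr hL) !(poisson_leibniz hP) !iotaE; ring.
Qed.

Lemma strong_bracket3_fundamental x y z u v :
  br3 (br3 x y z) u v =
    br3 (br3 x u v) y z + br3 (br3 y u v) z x + br3 (br3 z u v) x y.
Proof.
pose S h := iota (br h x) * iota (br y z) + iota (br h y) * iota (br z x) +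
  iota (br h z) * iota (br x y).
have S0 h : S h = 0.
  by rewrite /S -!unitization_inM -!unitization_inD (strong_identity strong).
apply: (@unitization_in_inj _ _ _ hA); rewrite {1 3 5 7}/poisson_bracket3.
rewrite (lie_anti hL u (br3 x y z)) (lie_anti hL y (br3 x u v)).
rewrite (lie_anti hL z (br3 y u v)) (lie_anti hL x (br3 z u v)).
rewrite !strong_br_bracket3 /poisson_bracket3.
rewrite !(lie_derivation hL u) !(lie_derivation hL v).
rewrite (lie_anti hL u x) (lie_anti hL u y) (lie_anti hL u z).
rewrite !(lie_oppr hL) !iotaE.
(* The right-hand side exceeds the left-hand side by the terms in
   u[v,x][y,z] and v[x,u][y,z]. *)
apply/esym/subr0_eq; transitivity (iota u * S v - iota v * S u).
  by rewrite /S /iota; ring.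
by rewrite !S0 !mulr0 subr0.
Qed.

End PoissonAlgebra.

Theorem theorem4p14 (K : fieldType) (charK0 : [pchar K]%R =i pred0)
    (L : lmodType K) (mul br : L -> L -> L)
    (hP : poisson_algebra mul br) :
  (three_lie_algebra (poisson_bracket3 mul br) ->
   transposed_poisson_3lie_algebra mul (poisson_bracket3 mul br))
  /\
  (strong_poisson_algebra mul br ->
   three_lie_algebra (poisson_bracket3 mul br) /\
   transposed_poisson_3lie_algebra mul (poisson_bracket3 mul br)).
Proof.
have transposed : three_lie_algebra (poisson_bracket3 mul br) ->
    transposed_poisson_3lie_algebra mul (poisson_bracket3 mul br).
  move=> h3; split=> //; first exact: poisson_mul hP.
  exact: bracket3_transposed_leibniz hP.
split=> // strong.
have h3 : three_lie_algebra (poisson_bracket3 mul br).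
  split.
  - exact: bracket3_trilinear hP.
  - exact: bracket3_skew hP.
  - exact: strong_bracket3_fundamental hP strong.
by split=> //; apply: transposed.
Qed.
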